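(* Let $n\ge 2$. For $k=0,1,\dots,\lfloor n/2\rfloor$, $$\mathbb{P}(\tilde C_2^*(n)=k)=\left(\frac12\right)^k\frac1{k!}\sum_{l=0}^{\lfloor n/2\rfloor-k}(-1)^l\left(\frac12\right)^l\frac1{l!}\,\frac{n_{[2l+2k]}}{(n-1)^{2l+2k}}.$$
   Context: Write $[n]=\{1,\dots,n\}$. For $n\ge 2$, the screaming toes mapping of size $n$ is the random mapping $f:[n]\to[n]$, $f(i)=B_i$, where $B_1,\dots,B_n$ are independent and $\mathbb{P}(B_i=j)=1/(n-1)$ for $j\in[n]\setminus\{i\}$; equivalently, $f$ is uniform over the $(n-1)^n$ mappings with no fixed points. The core of $f$ is the set of elements lying in cycles of $f$ (elements $i$ with $f^k(i)=i$ for some $k\ge1$), on which $f$ acts as a permutation. $\tilde C_j^*(n)$ is the number of cycles of length $j$ in the core; in particular $\tilde C_2^*(n)$ is the number of unordered pairs $\{i,j\}$, $i\neq j$, with $f(i)=j$ and $f(j)=i$. $n_{[j]}=n(n-1)\cdots(n-j+1)$ is the falling factorial, with $n_{[0]}=1$. *)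

(* Defs.v *)
From HB Require Import structures.
From mathcomp Require Import all_boot all_order all_algebra.
From mathcomp Require Import all_classical all_reals all_analysis.

Set Implicit Arguments.
Unset Strict Implicit.
Unset Printing Implicit Defensive.

Import Order.TTheory GRing.Theory Num.Theory.

Local Open Scope ring_scope.
Local Open Scope classical_set_scope.

(* Random elements of a finite type U, which carries the discrete
   sigma-algebra: every subset of U is an event. *)
Definition discrete_rv (d : measure_display) (T : measurableType d)
    (U : finType) (X : T -> U) : Prop :=
  forall A : set U, measurable (X @^-1` A).

Definition independent_rvs (d : measure_display) (T : measurableType d)
    (R : realType) (P : probability T R) (I U : finType) (X : I -> T -> U) :
    Prop :=
  forall (S : {set I}) (A : I -> set U),
    P (\bigcap_(i in [set` S]) (X i @^-1` A i)) =
    (\prod_(i in S) P (X i @^-1` A i))%E.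

(* The set [n] is represented by 'I_n, that is {0, ..., n - 1}. The value
   P(B_i = i) = 0 follows, for n >= 2, from the law on the other points. *)
Definition screaming_toes (n : nat) (d : measure_display)
    (T : measurableType d) (R : realType) (P : probability T R)
    (f : T -> {ffun 'I_n -> 'I_n}) : Prop :=
  let B (i : 'I_n) (w : T) : 'I_n := f w i in
  [/\ forall i, discrete_rv (B i),
      independent_rvs P B &
      forall i j, j != i -> P [set w | B i w = j] = ((n%:R - 1)^-1)%:E].

Definition core (n : nat) (f : {ffun 'I_n -> 'I_n}) : {set 'I_n} :=
  [set i | `[< exists k : nat, (1 <= k)%N /\ iter k f i = i >]]%SET.

(* A cycle is identified with the set of its elements, i.e. with the forward
   orbit of any of its (core) elements. *)
Definition cycles (n : nat) (f : {ffun 'I_n -> 'I_n}) : {set {set 'I_n}} :=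
  [set [set j in orbit f i]%SET | i in core f]%SET.

Definition cycle_count (n : nat) (f : {ffun 'I_n -> 'I_n}) (j : nat) : nat :=
  #|[set c in cycles f | #|c| == j]%SET|.

(* Main.v *)
(* The map f is uniform over the fixed-point-free maps g. With c(g) the number
   of 2-cycles of g, the m-th factorial moment of c comes from counting in two
   ways the pairs (g, ordered list of m disjoint oriented 2-cycles of g): there
   are n_[2m] such lists on [n], each realised by (n - 1)^(n - 2m) maps g,
   whereas a given g has 2^m c(g)_[m] of them. The law of c then follows from its
   factorial moments by inclusion-exclusion. *)
Require Import Defs.
From HB Require Import structures.
From mathcomp Require Import all_boot all_order all_algebra.
From mathcomp Require Import all_classical all_reals all_analysis.
From mathcomp Require Import zify ring lra.

Set Implicit Arguments.
Unset Strict Implicit.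
Unset Printing Implicit Defensive.

Import Order.TTheory GRing.Theory Num.Theory.

Local Open Scope ring_scope.

(* Each 2-cycle is represented by its smaller element. *)
Definition swapped_up (n : nat) (g : {ffun 'I_n -> 'I_n}) : {set 'I_n} :=
  [set i | (g (g i) == i) && (i < g i)%N].

(** The map sending [i] to [{i, g i}] is injective on [swapped_up g], and its image is the set of
    two-element cycles. *)
Lemma cycle_count2 (n : nat) (g : {ffun 'I_n -> 'I_n}) :
  cycle_count g 2 = #|swapped_up g|.
Proof.
rewrite /cycle_count -(@card_in_imset _ _ (fun i => [set i; g i]%SET)); last first.
  move=> i j; rewrite !inE => /andP[/eqP ggi ltigi] /andP[/eqP ggj ltjgj] eqij.
  (* The alternative [i = g j] would give [i < g i = j < g j = i]. *)
  have := set21 i (g i); rewrite eqij !inE => /orP[/eqP //|/eqP iE].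
  by move: ltigi ltjgj; rewrite iE ggj; lia.
apply: eq_card => c; rewrite inE; apply/andP/imsetP.
- case=> /imsetP[i]; rewrite inE => /asboolP[[|k] [// _ ik]] ->.
  rewrite cardsE (card_uniqP (orbit_uniq g i)) size_orbit => /eqP o2.
  have ggi : g (g i) = i.
    (* A periodic point returns after as many steps as its orbit has elements, here two. *)
    have : exists k, iter k.+1 g i = i by exists k.
    by move/(orbitPcycle 3 4); rewrite o2.
  have gi : i != g i.
    by have := orbit_uniq g i; rewrite /orbit o2 /= inE andbT.
  have cE : [set j in orbit g i]%SET = [set i; g i]%SET.
    by apply/setP => j; rewrite /orbit o2 !inE.
  rewrite cE; case: (ltngtP i (g i)) => [lt|lt|/val_inj eqi].
  + by exists i => //; rewrite inE ggi eqxx.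
  + by exists (g i); rewrite ?inE ?ggi ?eqxx // finset.setUC.
  + by rewrite -eqi eqxx in gi.
- case=> i; rewrite inE => /andP[/eqP ggi lt] ->.
  have ne : i != g i by apply: contraTneq lt => <-; rewrite ltnn.
  rewrite cards2 ne; split=> //; apply/imsetP; exists i.
    by rewrite inE; apply/asboolP; exists 2%N.
  apply/setP => j; rewrite !inE -fconnect_orbit.
  apply/idP/idP => [/orP[]/eqP->|/iter_findex <-];
    [exact: connect0|exact: fconnect1|].
  by elim: findex => [|m /orP[]/eqP E]; rewrite /= ?eqxx // E ?ggi eqxx ?orbT.
Qed.

(* [h] lists [m] distinct 2-cycles of [g] in order, each with a distinguished
   starting point [h (false, s)]. *)
Definition lists_swaps (n m : nat) (g : {ffun 'I_n -> 'I_n})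
    (h : {ffun bool * 'I_m -> 'I_n}) : bool :=
  injectiveb h && [forall s, g (h s) == h (~~ s.1, s.2)].

Lemma card_lists_swaps (n m : nat) (g : {ffun 'I_n -> 'I_n}) :
  #|[set h | @lists_swaps n m g h]%SET| = (2 ^ m * #|swapped_up g| ^_ m)%N.
Proof.
pose X := finset.setX [set: {ffun 'I_m -> bool}]%SET
  [set a : {ffun 'I_m -> 'I_n} in ffun_on (mem (swapped_up g)) | injectiveb a]%SET.
(* A list amounts to an injective sequence of smaller elements and, for each cycle, one bit telling
   whether it starts at its larger element. [psi] recovers both by comparing the two entries. *)
pose phi (x : {ffun 'I_m -> bool} * {ffun 'I_m -> 'I_n}) :
    {ffun bool * 'I_m -> 'I_n} :=
  [ffun s => if s.1 (+) x.1 s.2 then g (x.2 s.2) else x.2 s.2].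
pose psi (h : {ffun bool * 'I_m -> 'I_n}) :=
  ([ffun s => (h (true, s) < h (false, s))%N],
   [ffun s => if (h (true, s) < h (false, s))%N then h (true, s)
              else h (false, s)]) : {ffun 'I_m -> bool} * {ffun 'I_m -> 'I_n}.
have phiK : {in X, cancel phi psi}.
  move=> [e a]; rewrite !inE /= => /andP[/ffun_onP Aa _].
  congr pair; apply/ffunP => s; rewrite !ffunE /=;
    have := Aa s; rewrite inE => /andP[_ lt]; case: (e s);
    by rewrite /= ?lt // ltnNge ltnW.
transitivity #|X|; last first.
  by rewrite cardsX cardsT card_ffun card_bool card_inj_ffuns_on card_ord.
rewrite -(card_in_imset (can_in_inj phiK)); apply: eq_card => h.
rewrite inE; apply/idP/imsetP => [/andP[/injectiveP injh /forallP gh]|].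
- have ghE b s : g (h (b, s)) = h (~~ b, s) by exact/eqP/(gh (b, s)).
  have neh s : (h (true, s) : nat) != h (false, s).
    by apply/eqP => /val_inj/injh.
  exists (psi h); last first.
    apply/ffunP => -[b s]; rewrite !ffunE /=; have := neh s.
    by case: b; case: ltngtP; rewrite ?ghE.
  rewrite !inE /=; apply/andP; split.
    apply/ffun_onP => s; rewrite inE ffunE; have := neh s.
    by case: ltngtP => // lt _; rewrite !ghE eqxx.
  apply/injectiveP => s t; rewrite !ffunE.
  by case: ifP => _; case: ifP => _ /injh[].
- case=> -[e a]; rewrite !inE /= => /andP[/ffun_onP Aa /injectiveP inja] ->.
  have ga s : g (g (a s)) = a s by have := Aa s; rewrite inE => /andP[/eqP].
  have lta s : (a s < g (a s))%N by have := Aa s; rewrite inE => /andP[].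
  apply/andP; split; last first.
    apply/forallP => -[b s]; rewrite !ffunE /=.
    by case: b (e s) => -[] /=; rewrite ?ga.
  apply/injectiveP => -[b s] [c t]; rewrite !ffunE /=.
  (* These booleans tell larger elements from smaller ones. The larger element of one listed cycle
     is never the smaller element of another. *)
  case Eb: (b (+) e s); case Ec: (c (+) e t) => E.
  + have st : s = t by apply: inja; rewrite -ga E ga.
    by move: Eb Ec; rewrite st; case: b c (e t) => -[] [].
  + by have := lta t; rewrite -E ga ltnNge (ltnW (lta s)).
  + by have := lta s; rewrite E ga ltnNge (ltnW (lta t)).
  + have st := inja _ _ E.
    by move: Eb Ec; rewrite st; case: b c (e t) => -[] [].
Qed.

Definition no_fixpoint (n : nat) (g : {ffun 'I_n -> 'I_n}) : bool :=
  [forall i, g i != i].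

Lemma card_no_fixpoint_lists_swaps (n m : nat) (h : {ffun bool * 'I_m -> 'I_n}) :
  injective h ->
  #|[set g | no_fixpoint g && lists_swaps g h]%SET| = (n.-1 ^ (n - 2 * m))%N.
Proof.
move=> injh.
(* The admissible values at each point: one forced value at each of the [2 * m] points listed by
   [h], and any of the [n.-1] values other than [i] elsewhere. Injectivity of [h] keeps the forced
   values from creating fixed points. *)
pose F (i : 'I_n) : {pred 'I_n} :=
  if [pick s | h s == i] is Some s then pred1 (h (~~ s.1, s.2)) else predC1 i.
have -> : #|[set g | no_fixpoint g && lists_swaps g h]%SET| =
    #|(family F : simpl_pred {ffun 'I_n -> 'I_n})|.
  apply: eq_card => g; rewrite inE; apply/andP/familyP.
  - case=> /forallP nf /andP[_ /forallP gh] i; rewrite /F.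
    by case: pickP => [s /eqP <-|_]; rewrite inE.
  - move=> gF; have gh s : g (h s) = h (~~ s.1, s.2).
      have := gF (h s); rewrite /F.
      by case: pickP => [t /eqP/injh ->|/(_ s)]; rewrite ?inE ?eqxx // => /eqP.
    split; last first.
      by apply/andP; split; [exact/injectiveP|apply/forallP => s; rewrite gh].
    apply/forallP => i; have := gF i; rewrite /F.
    case: pickP => [s /eqP <- _|_]; rewrite ?inE //.
    by rewrite gh; apply/eqP => /injh; case: s => -[].
rewrite card_family foldrE big_map big_enum /=.
rewrite (bigID (mem (codom h))) /= big1 ?mul1n; last first.
  move=> i /codomP[s ->]; rewrite /F.
  by case: pickP => [t _|/(_ s)]; rewrite ?card1 ?eqxx.
rewrite (eq_bigr (fun=> n.-1)) => [|i hi].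
  rewrite prod_nat_const; congr (_ ^ _)%N.
  have := cardC (mem (codom h)); rewrite card_codom // card_prod card_bool.
  rewrite !card_ord => /(congr1 (subn^~ (2 * m)%N)); rewrite addKn => <-.
  exact: eq_card.
rewrite /F; case: pickP => [t /eqP E|_]; first by rewrite -E codom_f in hi.
by have := cardC1 i; rewrite card_ord.
Qed.

(** The truncated exponent is harmless: when [2 * m > n], the falling factorial vanishes. *)
Lemma factorial_moment_swaps (n m : nat) :
  (\sum_(g : {ffun 'I_n -> 'I_n} | no_fixpoint g)
      2 ^ m * #|swapped_up g| ^_ m = n ^_ (2 * m) * n.-1 ^ (n - 2 * m))%N.
Proof.
under eq_bigr do rewrite -card_lists_swaps -sum1dep_card big_mkcond.
rewrite exchange_big /=.
rewrite (bigID (fun h : {ffun _ -> _} => injectiveb h)) /= addnC big1 ?add0n.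
  rewrite (eq_bigr (fun=> n.-1 ^ (n - 2 * m))%N) => [|h /injectiveP injh].
    rewrite big_const iter_addn_0 mulnC; congr (_ * _)%N.
    have := card_inj_ffuns (bool * 'I_m)%type 'I_n.
    by rewrite card_prod card_bool !card_ord => <-; apply: eq_card => h; rewrite !inE.
  by rewrite -big_mkcondr sum1dep_card card_no_fixpoint_lists_swaps.
by move=> h /negbTE ninj; rewrite big1 // => g _; rewrite /lists_swaps ninj.
Qed.

(** With [c] 2-cycles there are [2 ^ c * c!], hence some, lists of all of them; such a list injects
    [2 * c] points into ['I_n]. *)
Lemma card_swapped_up_le (n : nat) (g : {ffun 'I_n -> 'I_n}) :
  (#|swapped_up g| <= n %/ 2)%N.
Proof.
have : (0 < #|[set h | @lists_swaps n #|swapped_up g| g h]%SET|)%N.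
  by rewrite card_lists_swaps ffactnn muln_gt0 expn_gt0 fact_gt0.
case/card_gt0P => h; rewrite inE => /andP[/injectiveP injh _].
by have := leq_card h injh; rewrite card_prod card_bool !card_ord; lia.
Qed.

(** Each term equals ['C(c, k) * (-1) ^+ l * 'C(c - k, l)], so the sum is
    ['C(c, k) * (1 - 1) ^+ (c - k)]. The bound [N] may exceed [c], so that one range of summation
    serves all maps. *)
Lemma alternating_ffact_sum (R : numFieldType) (N k c : nat) : (c <= N)%N ->
  \sum_(0 <= l < (N - k).+1) (-1) ^+ l * (c ^_ (k + l))%:R / (k`!%:R * l`!%:R)
    = (c == k)%:R :> R.
Proof.
move=> cN.
have ffactDr a b : (c ^_ (a + b) = c ^_ a * (c - a) ^_ b)%N.
  elim: b => [|b IH]; first by rewrite addn0 ffactn0 muln1.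
  by rewrite addnS !ffactnSr IH subnDA mulnA.
have fact_neq0 a : a`!%:R != 0 :> R by rewrite pnatr_eq0 -lt0n fact_gt0.
have termE l : (-1) ^+ l * (c ^_ (k + l))%:R / (k`!%:R * l`!%:R) =
    ('C(c, k))%:R * ((-1) ^+ l * ('C(c - k, l))%:R) :> R.
  rewrite ffactDr -!bin_ffact !natrM; field; by rewrite !fact_neq0.
under eq_bigr do rewrite termE.
rewrite -mulr_sumr; case: (ltnP c k) => [lt|kc].
  by rewrite bin_small // mul0r (ltn_eqF lt).
rewrite (@big_cat_nat _ _ _ (c - k).+1) //=; last by lia.
rewrite [X in _ + X]big_nat [X in _ + X]big1 => [|l /andP[lt _]]; last first.
  by rewrite bin_small // mulr0.
rewrite addr0 big_mkord.
under eq_bigr => i _ do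
  rewrite -[(-1) ^+ i]mulr1 -[1 in X in X * _](expr1n _ (c - k - i)).
transitivity ('C(c, k)%:R * (1 - 1) ^+ (c - k) : R).
  rewrite exprBn; congr (_ * _); apply: eq_bigr => i _.
  by rewrite !expr1n !mulr1 mulr_natr.
(* For [c = k] the value comes from [0 ^+ 0 = 1]. *)
rewrite subrr expr0n subn_eq0; case: (eqVneq c k) => [->|ne].
  by rewrite binn leqnn mulr1.
by rewrite leqNgt ltn_neqAle eq_sym ne kc mulr0.
Qed.

Local Open Scope classical_set_scope.

Lemma discrete_rv_law (d : measure_display) (T : measurableType d)
    (R : realType) (P : probability T R) (U : finType) (X : T -> U) (A : pred U) :
  discrete_rv X ->
  P [set w | A (X w)] = (\sum_(u | A u) P (X @^-1` [set u]))%E.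
Proof.
move=> mX.
have -> : [set w | A (X w)] = \bigcup_(u in [set` A]) (X @^-1` [set u]).
  by apply/seteqP; split => [w Aw|w [u Au XE]]; [by exists (X w)|rewrite /= XE].
rewrite measure_fin_bigcup //; last exact: trivIset_preimage1.
rewrite (fsbigE (enum A)) ?enum_uniq //.
- by rewrite big_enum_cond; apply: eq_bigl => u; rewrite /= mem_setE andbb.
- by move=> u /=; rewrite mem_enum.
- by move=> u /= Au; rewrite mem_enum => /negP[].
Qed.

Lemma screaming_toes_law (n : nat) (d : measure_display)
    (T : measurableType d) (R : realType) (P : probability T R)
    (f : T -> {ffun 'I_n -> 'I_n}) (g : {ffun 'I_n -> 'I_n}) :
  (2 <= n)%N -> screaming_toes P f ->
  P (f @^-1` [set g]) =
    (if no_fixpoint g then (n%:R - 1 : R)^-1 ^+ n else 0)%:E.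
Proof.
move=> n2 [mB iB pB].
have n1 : n%:R - 1 != 0 :> R by rewrite subr_eq0 pnatr_eq1; lia.
(* The other [n - 1] values already carry total mass 1. *)
have pBii i : P [set w | f w i = i] = 0%E.
  have := discrete_rv_law P predT (mB i).
  rewrite [X in P X](_ : _ = setT); last by apply/seteqP.
  rewrite probability_setT (bigD1 i) //=.
  rewrite [X in (_ + X)%E](eq_bigr (fun=> ((n%:R - 1 : R)^-1)%:E)) => [|j ji];
    last exact: pB.
  rewrite sumEFin sumr_const cardC1 card_ord -[_ *+ _]mulr_natl.
  rewrite -[in n.-1]subn1 natrB ?(ltnW n2) // divff //.
  have mS : measurable [set w | f w i = i] by exact: (mB i [set i]).
  rewrite -(fineK (fin_num_measure P _ mS)) -EFinD => -[p1].
  by congr EFin; lra.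
(* Independence over the full index set turns the mass of [g] into a product of coordinate masses; a
   fixed point gives a zero factor. *)
have fE : f @^-1` [set g] =
    \bigcap_(i in [set` [set: 'I_n]%SET]) ((fun w => f w i) @^-1` [set g i]).
  apply/seteqP; split => [w /= fg i _|w fg]; first by rewrite /= fg.
  apply/ffunP => i.
  by apply: (fg i); rewrite /= inE.
rewrite fE iB.
case: ifPn => [/forallP nf|/forallPn[i]].
  rewrite (eq_bigr (fun=> ((n%:R - 1 : R)^-1)%:E)) => [|i _]; last exact: pB.
  by rewrite prodEFin prodr_const cardsT card_ord.
rewrite negbK => /eqP gi.
by rewrite (bigD1 i) ?inE //= gi pBii mul0e.
Qed.

Theorem lemma2 (n : nat) (hn : (2 <= n)%N)
    (d : measure_display) (T : measurableType d) (R : realType)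
    (P : probability T R) (f : T -> {ffun 'I_n -> 'I_n})
    (hf : screaming_toes P f) (k : nat) (hk : (k <= n %/ 2)%N) :
  P [set w | cycle_count (f w) 2 = k] =
  ((1 / 2) ^+ k * (1 / k`!%:R) *
   \sum_(0 <= l < (n %/ 2 - k).+1)
      (-1) ^+ l * (1 / 2) ^+ l * (1 / l`!%:R) *
      ((n ^_ (2 * l + 2 * k))%:R / (n%:R - 1) ^+ (2 * l + 2 * k)))%:E.
Proof.
have n1E : (n.-1)%:R = n%:R - 1 :> R by rewrite -subn1 natrB //; lia.
have n1 : n%:R - 1 != 0 :> R by rewrite subr_eq0 pnatr_eq1; lia.
have mf : discrete_rv f.
  move=> A; have [mB _ _] := hf.
  have -> : f @^-1` A = \bigcup_(g in A) \bigcap_(i in [set: 'I_n])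
      ((fun w => f w i) @^-1` [set g i]).
    apply/seteqP; split => [w Aw|w [g Ag fg]]; first by exists (f w).
    by rewrite /preimage /= (_ : f w = g) //; apply/ffunP => i; exact: fg.
  apply: fin_bigcup_measurable => // g _.
  by apply: fin_bigcap_measurable => // i _; exact: mB.
transitivity (\sum_(g : {ffun 'I_n -> 'I_n} | no_fixpoint g)
    (#|swapped_up g| == k)%:R * (n%:R - 1 : R)^-1 ^+ n)%:E.
  rewrite [X in P X](_ : _ = [set w | #|swapped_up (f w)| == k]); last first.
    by apply/seteqP; split => w /=; rewrite cycle_count2 => /eqP.
  rewrite (discrete_rv_law P (fun g => #|swapped_up g| == k)) //.
  under eq_bigr do rewrite screaming_toes_law //.
  rewrite sumEFin big_mkcond [in RHS]big_mkcond; congr EFin.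
  by apply: eq_bigr => g _; case: eqP; case: ifP; rewrite ?mul1r ?mul0r.
congr EFin.
(* The indicator of [k] cycles is expanded with the bound [n %/ 2], the same for every [g], so the
   two sums can be exchanged. *)
under eq_bigr => g _ do
  rewrite -(alternating_ffact_sum R k (card_swapped_up_le g)) mulr_suml.
rewrite exchange_big mulr_sumr; apply: eq_big_nat => l /andP[_ lN].
have -> : (2 * l + 2 * k = 2 * (k + l))%N by lia.
have mN : (2 * (k + l) <= n)%N by lia.
have := congr1 (fun x => x%:R : R) (factorial_moment_swaps n (k + l)).
rewrite natr_sum /= natrM natrX n1E => moment.
(* The numerator becomes the factorial moment of order [k + l], whose factor [2 ^ (k + l)] cancels
   the powers of 1/2. *)
have -> : (n ^_ (2 * (k + l)))%:R / (n%:R - 1) ^+ (2 * (k + l)) =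
    (n ^_ (2 * (k + l)))%:R * (n%:R - 1) ^+ (n - 2 * (k + l)) / (n%:R - 1) ^+ n :> R.
  rewrite -[X in _ = _ / _ ^+ X](subnK mN) exprD invfM mulrA.
  by rewrite mulfK ?expf_neq0.
rewrite -moment !(mulr_sumr, mulr_suml); apply: eq_bigr => g _.
rewrite natrM natrX exprD exprVn !expr_div_n !expr1n; field.
have fact_neq0 a : a`!%:R != 0 :> R by rewrite pnatr_eq0 -lt0n fact_gt0.
by rewrite !fact_neq0 !expf_neq0.
Qed.
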